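(* Let $E: y^2=x^3+ax^2+bx+c$ ($a,b,c\in\mathbb{Z}$) be an elliptic curve and $P\in E(\mathbb{Q})$ a point of infinite order. If $2\mid e_t$ for some $t\ge0$, then for all $k\ge t$, either $F_k(E,P)=2$ or $F_k(E,P)$ is composite.
   Context: An elliptic curve is a non-singular cubic $y^2=x^3+ax^2+bx+c$ with $a,b,c\in\mathbb{Z}$. For $k\ge0$ write $2^kP=\left(\frac{m_k}{e_k^2},\frac{n_k}{e_k^3}\right)$ with $m_k,n_k,e_k\in\mathbb{Z}$, $e_k\ge1$, $\gcd(m_k,e_k)=\gcd(n_k,e_k)=1$. Define $F_0(E,P)=e_0$ and $F_k(E,P)=e_k/e_{k-1}$ for $k\ge1$. *)

(* Defs.v *)
From HB Require Import structures.
From mathcomp Require Import all_boot all_order all_algebra all_field.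
From Stdlib Require Import ClassicalEpsilon.

Set Implicit Arguments.
Unset Strict Implicit.
Unset Printing Implicit Defensive.

Import Order.TTheory GRing.Theory Num.Theory.

Local Open Scope ring_scope.

Definition weierstrass_cubic (F : fieldType) (a b c : int) : {poly F} :=
  'X^3 + a%:~R *: 'X^2 + b%:~R *: 'X + (c%:~R)%:P.

(* The partial derivatives of Y^2 - f(X) are 2Y and -f'(X). The point at      *)
(* infinity of a Weierstrass cubic is always smooth, so only the affine       *)
(* geometric points are constrained.                                          *)
Definition nonsingular (a b c : int) : Prop :=
  let f := weierstrass_cubic algC a b c in
  forall x y : algC, y ^+ 2 = f.[x] -> ~ (2 * y = 0 /\ f^`().[x] = 0).

Inductive point : Type := Infinity | Affine of rat & rat.

Definition on_curve (a b c : int) (P : point) : Prop :=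
  if P is Affine x y then y ^+ 2 = (weierstrass_cubic rat a b c).[x] else True.

(* Chord-and-tangent law; for points of the curve, the tangent slope is used  *)
(* only when the two points coincide and y1 != 0.                             *)
Definition ec_add (a b c : int) (P Q : point) : point :=
  match P, Q with
  | Infinity, _ => Q
  | _, Infinity => P
  | Affine x1 y1, Affine x2 y2 =>
      if (x1 == x2) && (y1 == - y2) then Infinity else
      let l := if x1 == x2
               then (weierstrass_cubic rat a b c)^`().[x1] / (2 * y1)
               else (y2 - y1) / (x2 - x1) in
      let x3 := l ^+ 2 - a%:~R - x1 - x2 in
      Affine x3 (l * (x1 - x3) - y1)
  end.

Definition ec_mul (a b c : int) (n : nat) (P : point) : point :=
  iter n (ec_add a b c P) Infinity.

Definition infinite_order (a b c : int) (P : point) : Prop :=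
  forall n : nat, (0 < n)%N -> ec_mul a b c n P <> Infinity.

Definition lowest_coords (P : point) (m n e : int) : Prop :=
  [/\ 1 <= e, gcdz m e = 1, gcdz n e = 1 &
      P = Affine (m%:~R / e%:~R ^+ 2) (n%:~R / e%:~R ^+ 3)].

(* The e-component is unique when it exists, and every affine rational point  *)
(* of a curve with integral coefficients admits such a representation; the    *)
(* choice operator only turns it into a total function.                       *)
Definition ec_den (P : point) : int :=
  epsilon (inhabits 0) (fun e => exists m n : int, lowest_coords P m n e).

Definition e_seq (a b c : int) (P : point) (k : nat) : int :=
  ec_den (ec_mul a b c (2 ^ k)%N P).

Definition ell_fermat (a b c : int) (P : point) (k : nat) : rat :=
  if k is j.+1 then (e_seq a b c P k)%:~R / (e_seq a b c P j)%:~R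
  else (e_seq a b c P 0)%:~R.

(* A rational number is composite when it is a composite natural number.      *)
Definition composite (q : rat) : Prop :=
  exists n : nat, [/\ q = n%:R, (1 < n)%N & ~~ prime n].

(* Main.v *)
(* Let 2^k P have denominator e, with x = m/e^2 and y = n/e^3.  The           *)
(* duplication formula gives x(2^(k+1) P) = N / (2 n e)^2 with                *)
(* N = m^4 mod e, so N is prime to e.  Hence e_k divides e_(k+1), and 2 e_k   *)
(* divides e_(k+1) as soon as e_k is even, because N is then odd.  So F_k is  *)
(* an even positive integer for every k >= t.                                 *)
(*                                                                            *)
(* Multiples being defined by repeated addition of P, duplication requires    *)
(* nP + nP = (2n)P.  Associativity is only needed when the outer sums are     *)
(* proper chords; infinite order of P and the cancellation law -P + (P + Q) = *)
(* Q guarantee this for the multiples of P involved.                          *)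

(* All the arithmetic sits in one integer equation, [lowest_coords_double]: m' (2ne)^2 = N e'^2,
   where N is congruent to m^4 modulo e. [dvdz_den_double] reads the two divisibilities off it, so
   evenness of the denominators persists from t on. For k >= 1 write e_k = q e_(k-1), so that F_k =
   q. If e_(k-1) is even, 2 e_(k-1) divides e_k and q is even; if it is odd, the factor 2 of e_k
   must lie in q. A positive even integer is 2 or composite. The geometric input is
   [lowest_coords_exist], which makes e_k meaningful, and [ec_mul_double], which rests on
   cancellation ([ec_addK]) and on associativity for chords ([ec_addA_generic]). *)
Require Import Defs.
From mathcomp Require Import all_boot all_order all_algebra all_field.
From mathcomp Require Import ring zify.
From Stdlib Require Import ClassicalEpsilon.

Set Implicit Arguments.
Unset Strict Implicit.
Unset Printing Implicit Defensive.

Import Order.TTheory GRing.Theory Num.Theory.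

Local Open Scope ring_scope.

(* Eliminating y1, y3, a, b and t leaves the relation B, which is linear in   *)
(* y2 with coefficient 2 (l - k); when l = k, the outer points coincide.      *)
Lemma chord_assoc (F : fieldType) (a b x1 y1 x2 y2 x3 y3 l k s t u v w : F) :
  (2 : F) != 0 ->
  l * (x1 - x2) = y1 - y2 ->
  l * (y1 + y2) = x1 ^+ 2 + x1 * x2 + x2 ^+ 2 + a * (x1 + x2) + b ->
  k * (x2 - x3) = y2 - y3 ->
  k * (y2 + y3) = x2 ^+ 2 + x2 * x3 + x3 ^+ 2 + a * (x2 + x3) + b ->
  s = l ^+ 2 - a - x1 - x2 -> t = k ^+ 2 - a - x2 - x3 ->
  s != x3 -> x1 != t ->
  u * (s - x3) = l * (x1 - s) - y1 - y3 ->
  v * (x1 - t) = y1 - (k * (x2 - t) - y2) ->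
  w = u ^+ 2 - a - s - x3 ->
  w = v ^+ 2 - a - x1 - t /\
  u * (s - w) - (l * (x1 - s) - y1) = v * (x1 - w) - y1.
Proof.
move=> two L1 L2 K1 K2 es et; rewrite -subr_eq0 => nsx3; rewrite -subr_eq0 => nxt U V W.
have ey1 : y1 = y2 + l * (x1 - x2) by rewrite L1; ring.
have ey3 : y3 = y2 - k * (x2 - x3) by rewrite K1; ring.
have ea : a = l ^+ 2 - s - x1 - x2 by rewrite es; ring.
have eb : b = l * (y1 + y2) - (x1 ^+ 2 + x1 * x2 + x2 ^+ 2 + a * (x1 + x2)).
  by rewrite L2; ring.
have eu : u = (l * (x1 - s) - y1 - y3) / (s - x3) by rewrite -U mulfK.
have ev : v = (y1 - (k * (x2 - t) - y2)) / (x1 - t) by rewrite -V mulfK.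
have eT : x3 - x1 = k ^+ 2 - l ^+ 2 + s - t by rewrite et ea; ring.
have B : 2 * y2 * (l - k) = (x3 - x2) * (t - x2) - (x1 - x2) * (s - x2).
  apply/eqP; rewrite -subr_eq0; apply/eqP.
  transitivity (x2 ^+ 2 + x2 * x3 + x3 ^+ 2 + a * (x2 + x3) + b - k * (y2 + y3)); last by rewrite -K2; ring.
  rewrite eb ey3 et ey1 es; ring.
have [lk|] := eqVneq l k.
  (* The line of slope [l] through (x2, y2) meets the cubic at abscissae x1, x2, s, and also at x2,
     x3, t; hence x3 is x1 or s. *)
  have /eqP : (x3 - x1) * (x3 - s) = 0.
    have e : t = x1 + s - x3 by rewrite et ea lk; ring.
    transitivity ((x1 - x2) * (s - x2) - (x3 - x2) * (t - x2)); first by rewrite e; ring.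
    apply/eqP; rewrite -oppr_eq0 opprB -B lk; apply/eqP; ring.
  rewrite mulf_eq0 => /orP [] /eqP h; last first.
    by move: nsx3; rewrite -oppr_eq0 opprB h eqxx.
  have {}h : x3 = x1 by rewrite -(subrK x1 x3) h add0r.
  have ts : t = s by rewrite et es lk h; ring.
  have uv : u = v.
    rewrite eu ev ts h ey3 ey1 lk h; field.
    by rewrite -ts nxt ts -h nsx3.
  split; first by rewrite W uv ts h; ring.
  apply/eqP; rewrite -subr_eq0; apply/eqP.
  transitivity (y1 - (k * (x2 - t) - y2) - v * (x1 - t)); last by rewrite V; ring.
  by rewrite uv ts ey1 lk; ring.
rewrite -subr_eq0 => nlk.
have ey2 : y2 = ((x3 - x2) * (t - x2) - (x1 - x2) * (s - x2)) / (2 * (l - k)).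
  by rewrite -B; field; rewrite two nlk.
have et' : t = k ^+ 2 - l ^+ 2 + s + x1 - x3 by rewrite et ea; ring.
rewrite W ev eu ey3 ey1 ey2 ea et'; split; field.
all: rewrite ?two ?nlk ?nsx3 -?et' ?nxt //.
Qed.

(** * The cubic, its derivative and smoothness at rational points *)

Lemma weierstrass_cubicE (F : fieldType) (a b c : int) (x : F) :
  (weierstrass_cubic F a b c).[x] =
  x ^+ 3 + a%:~R * x ^+ 2 + b%:~R * x + c%:~R.
Proof. by rewrite /weierstrass_cubic !hornerE. Qed.

Lemma deriv_weierstrass_cubicE (F : fieldType) (a b c : int) (x : F) :
  (weierstrass_cubic F a b c)^`().[x] =
  3 * x ^+ 2 + 2 * a%:~R * x + b%:~R.
Proof.
transitivity (x * x + x * (x + x) + a%:~R * (x + x) + b%:~R); last by ring.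
by rewrite /weierstrass_cubic !derivE !hornerE.
Qed.

Lemma nonsingular_rat (a b c : int) (x : rat) :
  nonsingular a b c -> (weierstrass_cubic rat a b c).[x] = 0 ->
  (weierstrass_cubic rat a b c)^`().[x] <> 0.
Proof.
move=> hE fx0 f'x0; apply: (hE (ratr x) 0).
  rewrite expr0n /= weierstrass_cubicE -[LHS](rmorph0 (ratr : rat -> algC)) -fx0.
  by rewrite weierstrass_cubicE !(rmorphD, rmorphM, rmorphXn) /= !ratr_int.
split; first by rewrite mulr0.
rewrite -[RHS](rmorph0 (ratr : rat -> algC)) -f'x0 !deriv_weierstrass_cubicE.
by rewrite 2!rmorphD 4!rmorphM /= !ratr_int !rmorph_nat.
Qed.

Definition ec_opp (P : point) : point :=
  if P is Affine x y then Affine x (- y) else Infinity.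

Lemma ec_oppK : involutive ec_opp.
Proof. by case=> //= x y; rewrite opprK. Qed.

Lemma on_curve_opp (a b c : int) (P : point) :
  on_curve a b c P -> on_curve a b c (ec_opp P).
Proof. by case: P => //= x y; rewrite sqrrN. Qed.

(** * The chord-and-tangent law *)

Section GroupLaw.

Variables a b c : int.
Hypothesis hE : nonsingular a b c.

Local Notation A := (a%:~R : rat).
Local Notation B := (b%:~R : rat).
Local Notation "P +e Q" := (ec_add a b c P Q) (at level 50, left associativity).
Local Notation on := (on_curve a b c).

(* The second equation is the divided difference of the curve equation, so    *)
(* chords and tangents satisfy the same two equations.                        *)
Definition is_slope (x1 y1 x2 y2 l : rat) : Prop :=
  l * (x1 - x2) = y1 - y2 /\
  l * (y1 + y2) = x1 ^+ 2 + x1 * x2 + x2 ^+ 2 + A * (x1 + x2) + B.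

Lemma on_curve_same_x x y1 y2 :
  on (Affine x y1) -> on (Affine x y2) -> y1 = y2 \/ y1 = - y2.
Proof.
move=> /= h1 h2; have /eqP := h1.
by rewrite -h2 eqf_sqr => /orP [] /eqP; [left | right].
Qed.

(** Removes the case split of [ec_add]: chord and tangent both give a slope obeying [is_slope], so
    later identities can be proved for the two cases at once. *)
Lemma ec_add_affine x1 y1 x2 y2 :
  on (Affine x1 y1) -> on (Affine x2 y2) ->
  Affine x1 y1 <> ec_opp (Affine x2 y2) ->
  exists2 l, is_slope x1 y1 x2 y2 l &
    let x3 := l ^+ 2 - A - x1 - x2 in
    Affine x1 y1 +e Affine x2 y2 = Affine x3 (l * (x1 - x3) - y1).
Proof.
move=> h1 h2 nopp /=.
have -> : (x1 == x2) && (y1 == - y2) = false.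
  by apply/negP => /andP [/eqP e1 /eqP e2]; apply: nopp; rewrite e1 e2.
eexists; last by reflexivity.
have [e|ne] := eqVneq x1 x2; last first.
  move: (ne); rewrite eq_sym -subr_eq0 => nz.
  split; first by field.
  move: h1 h2 => /=; rewrite !weierstrass_cubicE => h1 h2.
  transitivity ((y2 ^+ 2 - y1 ^+ 2) / (x2 - x1)); first by field.
  by rewrite h1 h2; field.
subst x2; have [e|e] := on_curve_same_x h1 h2; last first.
  by case: nopp; rewrite e.
subst y2; have ny : y1 != 0.
  by apply/eqP => y0; apply: nopp; rewrite /= y0 oppr0.
split; first by rewrite !subrr mulr0.
by rewrite deriv_weierstrass_cubicE; field.
Qed.

(** The difference of two slopes annihilates both x1 - x2 and y1 + y2, which vanish together only
    for opposite points. Hence a sum may be computed from any exhibited slope. *)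
Lemma is_slope_unique x1 y1 x2 y2 l l' :
  Affine x1 y1 <> ec_opp (Affine x2 y2) ->
  is_slope x1 y1 x2 y2 l -> is_slope x1 y1 x2 y2 l' -> l = l'.
Proof.
move=> nopp [p1 q1] [p2 q2]; apply/eqP; rewrite -subr_eq0; apply/negP => /negP n.
have /eqP : (l - l') * (x1 - x2) = 0 by rewrite mulrBl p1 p2 subrr.
have /eqP : (l - l') * (y1 + y2) = 0 by rewrite mulrBl q1 q2 subrr.
rewrite !mulf_eq0 (negbTE n) /= addr_eq0 subr_eq0 => /eqP ey /eqP ex.
by apply: nopp; rewrite ex ey.
Qed.

Lemma ec_addE x1 y1 x2 y2 l :
  on (Affine x1 y1) -> on (Affine x2 y2) ->
  Affine x1 y1 <> ec_opp (Affine x2 y2) ->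
  is_slope x1 y1 x2 y2 l ->
  let x3 := l ^+ 2 - A - x1 - x2 in
  Affine x1 y1 +e Affine x2 y2 = Affine x3 (l * (x1 - x3) - y1).
Proof.
move=> h1 h2 nopp sl; have [l' sl' ->] := ec_add_affine h1 h2 nopp.
by rewrite (is_slope_unique nopp sl sl').
Qed.

Lemma ec_addN P : ec_opp P +e P = Infinity.
Proof. by case: P => //= x y; rewrite !eqxx. Qed.

Lemma ec_addNr P : P +e ec_opp P = Infinity.
Proof. by rewrite -{1}(ec_oppK P) ec_addN. Qed.

Lemma ec_addO P : P +e Infinity = P.
Proof. by case: P. Qed.

Lemma ec_add_eqO P Q : P +e Q = Infinity -> P = ec_opp Q.
Proof.
case: P Q => [|x1 y1] [|x2 y2] //=.
by case: ifP => // /andP [/eqP -> /eqP ->].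
Qed.

Definition point_eq_dec (P Q : point) : {P = Q} + {P <> Q}.
Proof. by decide equality; apply: eq_comparable. Qed.

Lemma on_curve_add P Q : on P -> on Q -> on (P +e Q).
Proof.
move=> hP hQ; have [->|] := point_eq_dec P (ec_opp Q); first by rewrite ec_addN.
move: hP hQ; case: P Q => [|x1 y1] [|x2 y2] // h1 h2 nopp.
have [l [s1 s2] ->] := ec_add_affine h1 h2 nopp.
move: h1 => /=; rewrite !weierstrass_cubicE => h1.
set x3 := _ - x2.
(* Solving for the coefficients and y2 in terms of the slope turns the curve equation at the sum
   into a polynomial identity. *)
have eA : A = l ^+ 2 - x1 - x2 - x3 by rewrite /x3; ring.
have eB : B = l * (y1 + y2) - (x1 ^+ 2 + x1 * x2 + x2 ^+ 2 + A * (x1 + x2)).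
  by rewrite s2; ring.
have eC : c%:~R = y1 ^+ 2 - (x1 ^+ 3 + A * x1 ^+ 2 + B * x1) :> rat.
  by rewrite h1; ring.
have ey : y2 = y1 - l * (x1 - x2) by rewrite s1; ring.
by rewrite eC eB ey eA; ring.
Qed.

Lemma is_slope_sym x1 y1 x2 y2 l :
  is_slope x1 y1 x2 y2 l -> is_slope x2 y2 x1 y1 l.
Proof.
move=> [s1 s2]; split; first by rewrite -opprB mulrN s1 opprB.
by rewrite addrC s2; ring.
Qed.

Lemma ec_addC P Q : on P -> on Q -> P +e Q = Q +e P.
Proof.
move=> hP hQ; have [->|] := point_eq_dec P (ec_opp Q).
  by rewrite ec_addN ec_addNr.
move: hP hQ; case: P Q => [|x1 y1] [|x2 y2] // h1 h2 nopp.
have [l sl ->] := ec_add_affine h1 h2 nopp.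
rewrite (ec_addE h2 h1 _ (is_slope_sym sl)); last first.
  by move=> e; apply: nopp; rewrite e ec_oppK.
have ex : l ^+ 2 - A - x1 - x2 = l ^+ 2 - A - x2 - x1 by ring.
rewrite -ex; congr Affine.
case: sl => s1 _; have -> : y1 = y2 + l * (x1 - x2) by rewrite s1; ring.
by ring.
Qed.

Lemma ec_oppD P Q : on P -> on Q ->
  ec_opp (P +e Q) = ec_opp P +e ec_opp Q.
Proof.
move=> hP hQ; have [->|] := point_eq_dec P (ec_opp Q).
  by rewrite ec_addN ec_oppK ec_addNr.
move: hP hQ; case: P Q => [|x1 y1] [|x2 y2] // h1 h2 nopp.
have [l [s1 s2] ->] := ec_add_affine h1 h2 nopp.
rewrite /= -!/(ec_add a b c (Affine _ _) (Affine _ _)) (@ec_addE _ _ _ _ (- l)).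
- by rewrite sqrrN; congr Affine; ring.
- exact: (on_curve_opp h1).
- exact: (on_curve_opp h2).
- by case=> e1 e2; apply: nopp; rewrite e1 -[y1]opprK e2 opprK.
split; first by rewrite mulNr s1; ring.
by rewrite -s2; ring.
Qed.

(** Reflecting the line through P and Q gives a line of slope -l through -P and P + Q, whose
    remaining intersection is -Q. *)
Lemma ec_addK P Q : on P -> on Q -> ec_opp P +e (P +e Q) = Q.
Proof.
move=> hP hQ; have [->|] := point_eq_dec P (ec_opp Q).
  by rewrite ec_addN ec_addO ec_oppK.
move: hP hQ; case: P Q => [|x1 y1] [|x2 y2] // h1 h2 nopp.
  by rewrite ec_addO ec_addN.
have [l [s1 s2] e12] := ec_add_affine h1 h2 nopp.
have h3 := on_curve_add h1 h2.
rewrite e12 in h3 *; set x3 := _ - x2 in h3 *.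
have eA : A = l ^+ 2 - x1 - x2 - x3 by rewrite /x3; ring.
have eB : B = l * (y1 + y2) - (x1 ^+ 2 + x1 * x2 + x2 ^+ 2 + A * (x1 + x2)).
  by rewrite s2; ring.
have ey : y2 = y1 - l * (x1 - x2) by rewrite s1; ring.
have tangent : x3 = x1 -> 3 * x1 ^+ 2 + 2 * A * x1 + B = 2 * y1 * l.
  by move=> e; rewrite eB ey eA e; ring.
rewrite /= -/(ec_add a b c (Affine _ _) (Affine _ _)) (@ec_addE _ _ _ _ (- l)) //.
- rewrite sqrrN; have -> : l ^+ 2 - A - x1 - x3 = x2 by rewrite /x3; ring.
  by rewrite ey; congr Affine; ring.
- exact: (on_curve_opp h1).
(* Here P + Q = P, which forces y1 = 0; by [tangent] the derivative vanishes too, so P would be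
   singular. *)
- case=> e1 /oppr_inj e2.
  have y0 : y1 = 0.
    have : 2 * y1 = 0.
      transitivity (y1 + (l * (x1 - x3) - y1)); first by rewrite -e2; ring.
      by rewrite -e1; ring.
    by move/eqP; rewrite mulf_eq0 /= => /eqP.
  apply: (nonsingular_rat hE (x := x1)).
    by move: h1 => /= <-; rewrite y0 expr0n.
  by rewrite deriv_weierstrass_cubicE tangent // y0 mulr0 mul0r.
split; first by ring.
by rewrite eB ey eA; ring.
Qed.

Lemma ec_addI P Q R : on P -> on Q -> on R -> P +e Q = P +e R -> Q = R.
Proof. by move=> hP hQ hR e; rewrite -(ec_addK hP hQ) e ec_addK. Qed.

(** The four inequalities on the sums make the outer abscissae distinct, as [chord_assoc] requires;
    opposite inner pairs are settled by cancellation. *)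
Lemma ec_addA_generic P Q R : on P -> on Q -> on R ->
  Q <> Infinity ->
  P +e Q <> R -> P +e Q <> ec_opp R -> P <> Q +e R -> P <> ec_opp (Q +e R) ->
  (P +e Q) +e R = P +e (Q +e R).
Proof.
move=> hP hQ hR nQ.
have [->|] := point_eq_dec P (ec_opp Q).
  by rewrite ec_addN ec_addK.
have [->|] := point_eq_dec Q (ec_opp R).
  move=> _ _ _ _ _; rewrite ec_addN ec_addO.
  have hR' := on_curve_opp hR.
  rewrite (ec_addC hP) // ec_addC //; last exact: on_curve_add.
  by rewrite -{1}(ec_oppK R) ec_addK.
move: hP hQ hR nQ; case: P Q R => [|x1 y1] [|x2 y2] [|x3 y3] //;
  try by rewrite !ec_addO.
move=> h1 h2 h3 _ n23 n12.
have [l [l1 l2] e12] := ec_add_affine h1 h2 n12.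
have [k [k1 k2] e23] := ec_add_affine h2 h3 n23.
have h12 := on_curve_add h1 h2; have h23 := on_curve_add h2 h3.
rewrite e12 e23 in h12 h23 *.
set s := _ - x2 in h12 *; set t := _ - x3 in h23 *.
move=> m1 m2 m3 m4.
have ns : s != x3.
  apply/eqP => e; rewrite e in h12 m1 m2.
  by have [e'|e'] := on_curve_same_x h12 h3; [apply: m1 | apply: m2]; rewrite e'.
have nt : x1 != t.
  apply/eqP => e; rewrite -e in h23 m3 m4.
  by have [e'|e'] := on_curve_same_x h1 h23; [apply: m3 | apply: m4]; rewrite e'.
have [u [u1 u2] ->] := ec_add_affine h12 h3 m2.
have [v [v1 v2] ->] := ec_add_affine h1 h23 m4.
have [//|eX eY] := chord_assoc _ l1 l2 k1 k2 (erefl s) (erefl t) ns nt u1 v1 erefl.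
by rewrite eY eX.
Qed.

(** * Multiples of a point of infinite order *)

Section Multiples.

Variable P : point.
Hypothesis hP : on P.
Hypothesis hinf : infinite_order a b c P.

Local Notation Q n := (ec_mul a b c n P).

Lemma on_curve_mul n : on (Q n).
Proof. by elim: n => //= n; apply: on_curve_add. Qed.
#[local] Hint Resolve on_curve_mul : core.

Lemma ec_mulS n : Q n.+1 = P +e Q n.
Proof. by []. Qed.

Lemma ec_mul1 : Q 1 = P.
Proof. exact: ec_addO. Qed.

Lemma ec_mul_inj i j : Q i = Q j -> i = j.
Proof.
elim: i j => [|i IH] [|j] // e; first by case: (hinf (ltn0Sn j) (esym e)).
  by case: (hinf (ltn0Sn i) e).
by congr S; apply: IH; apply: (@ec_addI P); rewrite -?ec_mulS.
Qed.

(** Adding P to both sides trades (i, j+1) for (i+1, j), ending with (i+j)P at infinity. *)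
Lemma ec_mul_neq_opp i j : (0 < i + j)%N -> Q i <> ec_opp (Q j).
Proof.
elim: j i => [|j IH] i; first by rewrite addn0 => /hinf.
move=> _ e; apply: (IH i.+1) => //.
rewrite ec_mulS e ec_mulS ec_oppD //.
rewrite -{1}(ec_oppK P) ec_addK //; exact: on_curve_opp.
Qed.

(** Copies of P pass one at a time from the smaller multiple to the larger; strictness keeps the
    outer sums proper chords. *)
Lemma ec_mulD_lt i j : (i < j)%N -> Q i +e Q j = Q (i + j).
Proof.
elim: i j => [//|i IH] j ltij.
have [->|i0] := posnP i; first by rewrite ec_mul1.
rewrite ec_mulS (ec_addC hP (on_curve_mul i)) ec_addA_generic //.
- by rewrite -ec_mulS IH ?addSnnS // ltnW // ltnW.
- by rewrite -ec_mul1; apply: hinf.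
- rewrite (ec_addC (on_curve_mul i)) // -ec_mulS => /ec_mul_inj e.
  by rewrite e ltnn in ltij.
- by rewrite (ec_addC (on_curve_mul i)) // -ec_mulS; apply: ec_mul_neq_opp.
- by rewrite -ec_mulS => /ec_mul_inj e; rewrite e ltnNge leqW in ltij.
- by rewrite -ec_mulS; apply: ec_mul_neq_opp; rewrite addnS.
Qed.

(* Adding P to both sides replaces 2(nP) = (2n)P by nP + (n+1)P = (2n+1)P,    *)
(* a sum of two distinct multiples.                                           *)
Lemma ec_mul_double n : Q n +e Q n = Q (n + n).
Proof.
case: n => [//|[|n]]; first by rewrite ec_mul1 /= ec_addO.
set m := n.+2; have hm := on_curve_mul m.
have hmm := on_curve_add hm hm.
apply: (ec_addI hP) => //.
rewrite -ec_mulS (ec_addC hP hmm) ec_addA_generic //.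
- by rewrite (ec_addC hm hP) -ec_mulS ec_mulD_lt // addnS.
- exact: hinf.
(* 2(mP) = P would give mP = -(m-1)P; in the same way 2(mP) = -P would give mP = -(m+1)P. *)
- move=> e; apply: (@ec_mul_neq_opp m n.+1) => //.
  rewrite -{1}(ec_addK hm hm) e /m ec_mulS ec_oppD //.
  rewrite ec_addC; last 2 first.
  + by apply: on_curve_add; exact: on_curve_opp.
  + exact: hP.
  rewrite -{1}(ec_oppK P) ec_addK //; exact: on_curve_opp.
- move=> e; apply: (@ec_mul_neq_opp m m.+1) => //.
  rewrite -{1}(ec_addK hm hm) e ec_mulS (ec_addC hP hm) ec_oppD //.
- rewrite (ec_addC hm hP) -ec_mulS => /ec_mul_inj e.
  by move/eqP: e; rewrite eqn_leq ltnn andbF.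
- by rewrite (ec_addC hm hP) -ec_mulS; apply: ec_mul_neq_opp.
Qed.

End Multiples.
End GroupLaw.

(** * Denominators and duplication *)

Lemma dvdz_sqr_inv (d z : int) : (d ^+ 2 %| z ^+ 2)%Z -> (d %| z)%Z.
Proof. by rewrite !dvdzE !abszX dvdn_pexp2r. Qed.

Lemma coprimezMDl (k p q : int) : coprimez q (k * q + p) = coprimez q p.
Proof. by rewrite /coprimez gcdzMDl. Qed.

(* In lowest terms x = p/q and y = r/s, the equation of the curve forces      *)
(* s^2 = q^3, so that e = s/q.                                                *)
Lemma lowest_coords_exist (a b c : int) (P : point) :
  on_curve a b c P -> P <> Infinity ->
  exists e m n : int, lowest_coords P m n e.
Proof.
case: P => // x y /=; rewrite weierstrass_cubicE => h _.
set p := numq x; set q := denq x; set r := numq y; set s := denq y.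
have q0 : 0 < q := denq_gt0 x.
have s0 : 0 < s := denq_gt0 y.
have qQ : q%:~R != 0 :> rat by rewrite intr_eq0 gt_eqF.
have sQ : s%:~R != 0 :> rat by rewrite intr_eq0 gt_eqF.
have cpq : coprimez q p by rewrite coprimez_sym; exact: coprime_num_den.
have crs : coprimez s r by rewrite coprimez_sym; exact: coprime_num_den.
(* [g] is q^3 f(p/q), congruent to p^3 modulo q and so prime to q. *)
pose g := (a * p ^+ 2 + b * p * q + c * q ^+ 2) * q + p ^+ 3.
have E : r ^+ 2 * q ^+ 3 = s ^+ 2 * g.
  apply/eqP; rewrite -(eqr_int rat) /g !(rmorphD, rmorphM, rmorphXn) /=; apply/eqP.
  have hx : p%:~R = x * q%:~R by rewrite -[x in RHS]divq_num_den divfK.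
  have hy : r%:~R = y * s%:~R by rewrite -[y in RHS]divq_num_den divfK.
  rewrite hx hy; transitivity (y ^+ 2 * s%:~R ^+ 2 * q%:~R ^+ 3); first by ring.
  by rewrite h; ring.
have sq : s ^+ 2 = q ^+ 3.
  have d1 : (s ^+ 2 %| q ^+ 3)%Z.
    have cc : coprimez (s ^+ 2) (r ^+ 2) by rewrite coprimezXl // coprimezXr.
    by rewrite -(Gauss_dvdzr _ cc) E dvdz_mulr.
  have d2 : (q ^+ 3 %| s ^+ 2)%Z.
    have cc : coprimez (q ^+ 3) g by rewrite coprimezXl // /g coprimezMDl coprimezXr.
    by rewrite -(Gauss_dvdzl _ cc) -E dvdz_mull.
  have : (`|s ^+ 2| == `|q ^+ 3|)%N by rewrite eqn_dvd -!dvdzE d1 d2.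
  move/eqP/(congr1 Posz); rewrite !abszE.
  by rewrite !ger0_norm ?exprn_ge0 ?ltW.
have /dvdzP [e se] : (q %| s)%Z.
  by apply: dvdz_sqr_inv; rewrite sq exprS dvdz_mull.
have qe : q = e ^+ 2.
  have nz : q ^+ 2 != 0 by rewrite expf_neq0 // gt_eqF.
  by apply: (mulIf nz); rewrite -exprMn -se sq exprS.
have e3 : s = e ^+ 3 by rewrite se qe -exprS.
have e0 : 0 < e by move: s0; rewrite se pmulr_lgt0.
exists e, p, r; split.
- by rewrite -gtz0_ge1.
- apply/eqP; rewrite -/(coprimez p e) -(@coprimez_pexpr 2) // -qe coprimez_sym //.
- apply/eqP; rewrite -/(coprimez r e) -(@coprimez_pexpr 3) // -e3 coprimez_sym //.
- by rewrite -!rmorphXn -qe -e3 !divq_num_den.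
Qed.

Lemma ec_den_spec (a b c : int) (P : point) :
  on_curve a b c P -> P <> Infinity ->
  exists m n : int, lowest_coords P m n (ec_den P).
Proof.
move=> hP nP; apply: (@epsilon_spec _ (inhabits 0)
  (fun e => exists m n : int, lowest_coords P m n e)).
exact: lowest_coords_exist hP nP.
Qed.

(** The duplication formula x(2P) = (x^4 - 2bx^2 - 8cx + b^2 - 4ac) / (4y^2), cleared of
    denominators and with a factor e isolated in all terms but m^4. *)
Lemma lowest_coords_double (a b c m n e m' n' e' : int) (P : point) :
  on_curve a b c P -> lowest_coords P m n e ->
  lowest_coords (ec_add a b c P P) m' n' e' ->
  m' * (2 * n * e) ^+ 2 =
  ((- 2 * b * m ^+ 2 - 8 * c * m * e ^+ 2 + (b ^+ 2 - 4 * a * c) * e ^+ 4)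
     * e ^+ 3 * e + m ^+ 4) * e' ^+ 2.
Proof.
move=> hP [e1 _ _ eP] [e1' _ _ eP2].
have eQ : e%:~R != 0 :> rat by rewrite intr_eq0; apply/eqP; lia.
have eQ' : e'%:~R != 0 :> rat by rewrite intr_eq0; apply/eqP; lia.
rewrite eP in hP eP2.
set x := _ / _ in hP eP2; set y := _ / _ in hP eP2.
have nopp : Affine x y <> ec_opp (Affine x y).
  by move=> h; rewrite [X in ec_add _ _ _ X]h ec_addN in eP2.
have ny : y != 0.
  by apply/eqP => y0; apply: nopp; rewrite /= y0 oppr0.
have [l [_ l2] e2] := ec_add_affine hP hP nopp.
rewrite e2 in eP2; case: eP2 => ex _.
have el : l = (3 * x ^+ 2 + 2 * a%:~R * x + b%:~R) / (2 * y).
  have -> : 3 * x ^+ 2 + 2 * a%:~R * x + b%:~R = l * (y + y) by rewrite l2; ring.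
  by field.
have hx : m%:~R = x * e%:~R ^+ 2 by rewrite /x divfK // expf_neq0.
have hy : n%:~R = y * e%:~R ^+ 3 by rewrite /y divfK // expf_neq0.
have hx' : m'%:~R = (l ^+ 2 - a%:~R - x - x) * e'%:~R ^+ 2.
  by rewrite ex divfK // expf_neq0.
move: hP => /=; rewrite weierstrass_cubicE => hP.
have hc : c%:~R = y ^+ 2 - (x ^+ 3 + a%:~R * x ^+ 2 + b%:~R * x) by rewrite hP; ring.
apply/eqP; rewrite -(eqr_int rat).
rewrite !(rmorphD, rmorphB, rmorphN, rmorphM, rmorphXn) /=.
rewrite hx' el hx hy hc; apply/eqP; clearbody x y.
by field.
Qed.

(** N is prime to every divisor of e that is prime to m, in particular to e, and to 2 when e is
    even; Gauss's lemma then moves e^2 or (2e)^2 into e'^2. *)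
Lemma dvdz_den_double (a b c m n e m' n' e' : int) (P : point) :
  on_curve a b c P -> lowest_coords P m n e ->
  lowest_coords (ec_add a b c P P) m' n' e' ->
  (e %| e')%Z /\ ((2 %| e)%Z -> (2 * e %| e')%Z).
Proof.
move=> hP l1 l2; have E := lowest_coords_double hP l1 l2.
move: l1 => [_ /eqP cme _ _]; rewrite -/(coprimez m e) in cme.
set N := _ + m ^+ 4 in E.
have cN d : coprimez d m -> (d %| e)%Z -> coprimez d N.
  move=> cd /dvdzP [k ek]; rewrite /N ek [_ * (k * d)]mulrA coprimezMDl.
  exact: coprimezXr.
have ceN : coprimez e N by apply: cN; rewrite 1?coprimez_sym.
split=> [|e2]; apply: dvdz_sqr_inv.
  have cc : coprimez (e ^+ 2) N by rewrite coprimezXl.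
  by rewrite -(Gauss_dvdzr _ cc) -E exprMn mulrA dvdz_mull.
have c2 : coprimez 2 N.
  apply: cN => //; rewrite coprimez_sym; exact: coprimez_dvdr e2 cme.
have cc : coprimez ((2 * e) ^+ 2) N by rewrite coprimezXl // coprimezMl c2.
have e4 : (2 * n * e) ^+ 2 = n ^+ 2 * (2 * e) ^+ 2 by ring.
by rewrite -(Gauss_dvdzr _ cc) -E e4 mulrA dvdz_mull.
Qed.

Lemma even_two_or_composite (q : int) :
  0 < q -> (2 %| q)%Z -> (q%:~R : rat) = 2 \/ composite q%:~R.
Proof.
case: q => // n n0 d2; have [->|n2] := eqVneq n 2; first by left.
have {d2} : (2 %| n)%N by rewrite dvdzE in d2.
move=> d2; right; exists n; split=> //; first by case: n n0 n2 d2 => [|[|n]].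
apply/negP => pn; move: d2; rewrite dvdn_prime2 // => /eqP e.
by rewrite -e eqxx in n2.
Qed.

Theorem theorem6p1 (a b c : int) (P : point)
  (hE : nonsingular a b c)
  (hP : on_curve a b c P)
  (hinf : infinite_order a b c P)
  (t : nat) (ht : (2 %| e_seq a b c P t)%Z)
  (k : nat) (hk : (t <= k)%N) :
  ell_fermat a b c P k = 2 \/ composite (ell_fermat a b c P k).
Proof.
have spec j : exists m n,
    lowest_coords (ec_mul a b c (2 ^ j) P) m n (e_seq a b c P j).
  apply: (@ec_den_spec a b c); first exact: on_curve_mul.
  by apply: hinf; rewrite expn_gt0.
have e_gt0 j : 0 < e_seq a b c P j by have [m [n [h _ _ _]]] := spec j; lia.
have step j : (e_seq a b c P j %| e_seq a b c P j.+1)%Z /\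
    ((2 %| e_seq a b c P j)%Z -> (2 * e_seq a b c P j %| e_seq a b c P j.+1)%Z).
  have [m [n l1]] := spec j; have [m' [n' l2]] := spec j.+1.
  rewrite expnS mul2n -addnn -(ec_mul_double hE hP hinf) in l2.
  by apply: dvdz_den_double l1 l2; apply: on_curve_mul.
have even_k : (2 %| e_seq a b c P k)%Z.
  rewrite -(subnKC hk); elim: (k - t)%N => [|j IH]; first by rewrite addn0.
  by rewrite addnS; apply: dvdz_trans IH _; case: (step (t + j)%N).
case: k hk even_k => [|j] _ even_k; first exact: even_two_or_composite.
have [/dvdzP [q eq] step2] := step j.
have ej := e_gt0 j; have ej1 := e_gt0 j.+1.
have q0 : 0 < q by move: ej1; rewrite eq pmulr_lgt0.
have -> : ell_fermat a b c P j.+1 = q%:~R.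
  by rewrite /ell_fermat eq rmorphM mulfK // intr_eq0 gt_eqF.
apply: even_two_or_composite q0 _.
(* If e_j is even, cancel it in 2 e_j | q e_j; if odd, 2 is prime to e_j and divides q e_j. *)
have [e2|e2] := boolP (2 %| e_seq a b c P j)%Z.
  by have := step2 e2; rewrite eq dvdz_mul2r // gt_eqF.
by move: even_k; rewrite eq Gauss_dvdzl // coprimezE prime_coprime // -dvdzE.
Qed.
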